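(* Let $A,N\in\mathbb{R}^{n\times n}$, $B\in\mathbb{R}^{n\times m}$, $C\in\mathbb{R}^{p\times n}$, $D\in\mathbb{R}^{p\times m}$. Assume that the pair $(A,N)$ is asymptotically mean-square stable, and let $\gamma>\|D\|_2$. Let $P^\dagger\ge0$ be the Moore-Penrose inverse of the controllability Gramian $P$, where $P\ge 0$ is the solution of $AP+PA^T+NPN^T=-BB^T$. If $X\le0$ satisfies $$\begin{bmatrix} A^TX+XA+N^TXN-C^TC & XB-C^TD\\ B^TX-D^TC & \gamma^2 I-D^TD\end{bmatrix}\ge 0,$$ then $$0\le\operatorname{trace}(-B^TXB)\le m^2\gamma^2\|B^TP^\dagger B\|_2.$$
   Context: The pair $(A,N)$ is asymptotically mean-square stable if the solutions $x(t,x_0,0)$ of the Itô equation $dx=Ax\,dt+Nx\,dw$, $x(0)=x_0$ ($w$ a zero mean real Wiener process), satisfy $\mathcal{E}(\|x(t,x_0,0)\|^2)\to0$ as $t\to\infty$ for all $x_0$, where $\mathcal{E}$ denotes expectation; equivalently, all eigenvalues of the linear map $X\mapsto A^TX+XA+N^TXN$ on $\mathbb{R}^{n\times n}$ have negative real part. $\|\cdot\|_2$ is the spectral norm. Matrix inequalities refer to the Loewner (definiteness) order on real symmetric matrices; $X$ is real symmetric. *)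

(* Defs.v *)
From HB Require Import structures.
From mathcomp Require Import all_boot all_order all_algebra.
From mathcomp Require Import all_classical all_reals all_analysis.

Set Implicit Arguments.
Unset Strict Implicit.
Unset Printing Implicit Defensive.
Import Order.TTheory GRing.Theory Num.Theory.
Import numFieldNormedType.Exports.

Local Open Scope classical_set_scope.
Local Open Scope ring_scope.

Definition enorm (R : realType) (n : nat) (v : 'cV[R]_n) : R :=
  Num.sqrt (\sum_(i < n) v i ord0 ^+ 2).

(* The norm of 'M[R]_(m, n) in the analysis library is the entrywise maximum,
   so the operator norm for enorm is defined here. *)
Definition spectral_norm (R : realType) (m n : nat) (M : 'M[R]_(m, n)) : R :=
  sup [set enorm (M *m v) | v in [set v : 'cV[R]_n | enorm v <= 1]].

Definition psd (R : realType) (n : nat) (M : 'M[R]_n) : Prop :=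
  M^T = M /\ forall v : 'cV[R]_n, 0 <= (v^T *m M *m v) ord0 ord0.

Definition loewner_le (R : realType) (n : nat) (X Y : 'M[R]_n) : Prop :=
  psd (Y - X).

(* The four Penrose equations, which determine Mp; pinvmx is only a partial
   inverse and does not satisfy the two symmetry equations in general. *)
Definition moore_penrose (R : realType) (m n : nat)
    (M : 'M[R]_(m, n)) (Mp : 'M[R]_(n, m)) : Prop :=
  [/\ M *m Mp *m M = M, Mp *m M *m Mp = Mp,
      (M *m Mp)^T = M *m Mp & (Mp *m M)^T = Mp *m M].

Definition controllability_gramian (R : realType) (n m : nat)
    (A N : 'M[R]_n) (B : 'M[R]_(n, m)) (P : 'M[R]_n) : Prop :=
  loewner_le 0 P /\ A *m P + P *m A^T + N *m P *m N^T = - (B *m B^T).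

Definition measurable_wrt (R : realType) (T : Type)
    (G : set (set T)) (X : T -> R) : Prop :=
  forall Y : set R, measurable Y -> G (X @^-1` Y).

(* Processes and filtrations are indexed by R; only times t >= 0 matter. *)
Definition filtration (R : realType) (d : measure_display)
    (T : measurableType d) (F : R -> set (set T)) : Prop :=
  [/\ forall t : R, 0 <= t -> sigma_algebra setT (F t),
      forall t : R, 0 <= t -> F t `<=` measurable &
      forall s t : R, 0 <= s -> s <= t -> F s `<=` F t].

Definition increment (R : realType) (T : Type) (w : R -> T -> R) (s t : R)
    (om : T) : R :=
  w t om - w s om.

Definition mean_square (R : realType) (d : measure_display)
    (T : measurableType d) (Pr : probability T R) (X : T -> R) : \bar R :=
  (\int[Pr]_om (X om ^+ 2)%:E)%E.

(* The second parameter of normal_prob is the standard deviation. *)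
Definition wiener_process (R : realType) (d : measure_display)
    (T : measurableType d) (Pr : probability T R)
    (F : R -> set (set T)) (w : R -> T -> R) : Prop :=
  [/\ forall t : R, 0 <= t -> measurable_wrt (F t) (w t),
      {ae Pr, forall om, w 0 om = 0},
      {ae Pr, forall om, {within `[0, +oo[, continuous (w ^~ om)}},
      forall s t : R, 0 <= s -> s < t -> forall Y : set R, measurable Y ->
        Pr (increment w s t @^-1` Y) = normal_prob 0 (Num.sqrt (t - s)) Y &
      forall s t : R, 0 <= s -> s < t ->
        forall (E : set T) (Y : set R), F s E -> measurable Y ->
        Pr (E `&` increment w s t @^-1` Y)
          = (Pr E * Pr (increment w s t @^-1` Y))%E].

(* (k, tau, xi) encodes the process equal to xi j on ]tau j, tau j.+1] for
   j < k, and to 0 elsewhere. *)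
Definition elementary (R : realType) (d : measure_display)
    (T : measurableType d) (Pr : probability T R) (F : R -> set (set T))
    (k : nat) (tau : nat -> R) (xi : nat -> T -> R) : Prop :=
  [/\ 0 <= tau 0%N,
      forall j, (j < k)%N -> tau j <= tau j.+1,
      forall j, (j < k)%N -> measurable_wrt (F (tau j)) (xi j) &
      forall j, (j < k)%N -> (mean_square Pr (xi j) < +oo)%E].

Definition elementary_process (R : realType) (T : Type)
    (k : nat) (tau : nat -> R) (xi : nat -> T -> R) (s : R) (om : T) : R :=
  \sum_(j < k) xi j om * \1_(`]tau j, tau j.+1]%classic) s.

Definition elementary_ito (R : realType) (T : Type) (w : R -> T -> R)
    (k : nat) (tau : nat -> R) (xi : nat -> T -> R) (t : R) (om : T) : R :=
  \sum_(j < k)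
    xi j om * (w (Num.min (tau j.+1) t) om - w (Num.min (tau j) t) om).

(* J is a version of the Ito integral of f dw over [0, t]: the L^2(Pr)-limit of
   the integrals of elementary processes that converge to f in
   L^2([0, t] x Pr). *)
Definition ito_integral (R : realType) (d : measure_display)
    (T : measurableType d) (Pr : probability T R)
    (F : R -> set (set T)) (w : R -> T -> R)
    (f : R -> T -> R) (t : R) (J : T -> R) : Prop :=
  measurable_fun setT J /\
  exists (k : nat -> nat) (tau : nat -> nat -> R) (xi : nat -> nat -> T -> R),
  [/\ forall i, elementary Pr F (k i) (tau i) (xi i),
      (fun i => \int[lebesgue_measure]_(s in `[0%R, t])
         mean_square Pr (fun om =>
           (f s om - elementary_process (k i) (tau i) (xi i) s om)%R))%E
        @ \oo --> 0%E &
      (fun i => mean_square Pr (fun om =>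
         J om - elementary_ito w (k i) (tau i) (xi i) t om))
        @ \oo --> 0%E].

(* x solves dx = A x dt + N x dw, x(0) = x0, in integrated form. *)
Definition ito_solution (R : realType) (d : measure_display)
    (T : measurableType d) (Pr : probability T R)
    (F : R -> set (set T)) (w : R -> T -> R) (n : nat)
    (A N : 'M[R]_n) (x0 : 'cV[R]_n) (x : R -> T -> 'cV[R]_n) : Prop :=
  [/\ forall (i : 'I_n) (t : R), 0 <= t -> measurable_wrt (F t) (fun om => x t om i ord0),
      forall i : 'I_n, measurable_fun [set z : measurableTypeR R * T | 0 <= z.1]
        (fun z => x z.1 z.2 i ord0),
      {ae Pr, forall om (i : 'I_n),
        {within `[0, +oo[, continuous (fun t => x t om i ord0)}} &
      forall (i : 'I_n) (t : R), 0 <= t -> exists2 J : T -> R,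
        ito_integral Pr F w (fun s om => (N *m x s om) i ord0) t J &
        {ae Pr, forall om, x t om i ord0 =
          x0 i ord0
          + \int[lebesgue_measure]_(s in `[0, t]) (A *m x s om) i ord0
          + J om}].

(* The law of the solution depends only on x0, so the quantification over all
   filtered probability spaces and Wiener processes is not a restriction. *)
Definition mean_square_stable (R : realType) (n : nat) (A N : 'M[R]_n) : Prop :=
  forall (d : measure_display) (T : measurableType d) (Pr : probability T R)
    (F : R -> set (set T)) (w : R -> T -> R)
    (x0 : 'cV[R]_n) (x : R -> T -> 'cV[R]_n),
  filtration F -> wiener_process Pr F w -> ito_solution Pr F w A N x0 x ->
  mean_square Pr (fun om => enorm (x t om)) @[t --> +oo%R] --> 0%E.

(* Main.v *)
Require Import Defs.
From HB Require Import structures.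
From mathcomp Require Import all_boot all_order all_algebra.
From mathcomp Require Import all_classical all_reals all_analysis.
From mathcomp Require Import ring lra.
Set Implicit Arguments.
Unset Strict Implicit.
Unset Printing Implicit Defensive.
Import Order.TTheory GRing.Theory Num.Theory.
Local Open Scope ring_scope.

(** Testing the matrix inequality on the graph of [K = B^T P^+] and pairing the
    result with [P] in the trace form gives
    [0 <= tr (X B B^T) + gamma^2 tr (K P K^T)], up to a nonpositive term.
    The Gramian equation forces [ker P] into [ker B^T], so [K P = B^T] and the
    last trace is [tr (B^T P^+ B)], a sum of [m] diagonal entries each bounded by
    the spectral norm. *)

Definition nonneg_form (R : realType) (n : nat) (M : 'M[R]_n) : Prop :=
  forall v : 'cV[R]_n, 0 <= (v^T *m M *m v) ord0 ord0.

Lemma mxE00D (R : realType) (M N : 'M[R]_1) :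
  (M + N) ord0 ord0 = M ord0 ord0 + N ord0 ord0.
Proof. by rewrite mxE. Qed.

Lemma nonneg_form_congr (R : realType) (n k : nat) (M : 'M[R]_n)
    (V : 'M[R]_(n, k)) :
  nonneg_form M -> nonneg_form (V^T *m M *m V).
Proof. by move=> hM v; have := hM (V *m v); rewrite trmx_mul !mulmxA. Qed.

Lemma nonneg_form_gram (R : realType) (n k : nat) (V : 'M[R]_(n, k)) :
  nonneg_form (V^T *m V).
Proof.
move=> v; rewrite mulmxA -trmx_mul -mulmxA mxE.
by apply: sumr_ge0 => i _; rewrite mxE -expr2 sqr_ge0.
Qed.

Lemma nonneg_form_tr (R : realType) (n : nat) (M : 'M[R]_n) :
  nonneg_form M -> 0 <= \tr M.
Proof.
move=> hM; apply: sumr_ge0 => i _.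
have := hM (delta_mx i 0).
by rewrite -colE trmx_delta -rowE !mxE.
Qed.

(* When the pivot [a] vanishes so does the column [b], and then the junk value
   [a^-1 = 0] makes the same Cholesky step valid. *)
Lemma psd_cholesky (R : realType) (n : nat) (P : 'M[R]_n) :
  psd P -> exists L : 'M[R]_n, P = L *m L^T.
Proof.
elim: n P => [|n IHn] P; first by exists 0; apply/matrixP => -[].
rewrite -[n.+1]/(1 + n)%N in P *.
rewrite -(submxK P).
set U := ulsubmx P; set b := dlsubmx P; set S := drsubmx P.
case=> symP posP.
have [_ Eb _ symS] := eq_block_mx (etrans (esym (tr_block_mx _ _ _ _)) symP).
have {}Eb : ursubmx P = b^T by rewrite -Eb.
rewrite Eb in posP *.
have [a EU] : exists a : R, U = a%:M by exists (U 0 0); exact: mx11_scalar.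
rewrite EU in posP *.
clearbody U b S.
(* The quadratic form of [P] at the stacked vector with blocks [t] and [v]. *)
have form (t : R) (v : 'cV[R]_n) :
    0 <= t ^+ 2 * a + 2 * t * (b^T *m v) 0 0 + (v^T *m S *m v) 0 0.
  have := posP (col_mx t%:M v).
  rewrite tr_col_mx tr_scalar_mx mul_row_block mul_row_col !mul_scalar_mx.
  rewrite !mulmxDl !mxE00D.
  have -> : v^T *m b *m t%:M = t *: (b^T *m v).
    rewrite mul_mx_scalar -[v^T *m b]trmxK trmx_mul trmxK.
    by rewrite [b^T *m v]mx11_scalar tr_scalar_mx.
  rewrite scale_scalar_mx -scalar_mxM -scalemxAl !mxE /= mulr1n.
  by congr (0 <= _); ring.
have a_ge0 : 0 <= a.
  by have := form 1 0; rewrite !mulmx0 !mxE; lra.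
have b0 : a = 0 -> b = 0.
  move=> a0; apply/colP => i; rewrite mxE.
  set s : R := S i i.
  have H t : 0 <= 2 * t * b i 0 + s.
    have := form t (delta_mx i 0).
    by rewrite a0 -colE trmx_delta -rowE -colE !mxE mulr0 add0r.
  apply/eqP; apply: contraT => bi.
  (* An affine function of [t] that stays nonnegative has slope zero; this [t] would give it the
     value -1. *)
  have := H (- (s + 1) / (2 * b i 0)).
  have -> : 2 * (- (s + 1) / (2 * b i 0)) * b i 0 = - (s + 1) by field.
  lra.
have psdS : psd (S - a^-1 *: (b *m b^T)).
  split; first by rewrite linearB linearZ /= trmx_mul trmxK symS.
  (* For [a > 0] this [t] minimises the form, and the minimum is the form of the Schur complement.
     For [a = 0] it is [t = 0]. *)
  move=> v; have := form (- a^-1 * (b^T *m v) 0 0) v.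
  set q := (b^T *m v) 0 0.
  rewrite mulmxBr mulmxBl -scalemxAr -scalemxAl.
  have -> : v^T *m (b *m b^T) *m v = (q ^+ 2)%:M.
    rewrite mulmxA -mulmxA [b^T *m v]mx11_scalar -/q.
    rewrite -[v^T *m b]trmxK trmx_mul trmxK [b^T *m v]mx11_scalar -/q.
    by rewrite tr_scalar_mx -scalar_mxM expr2.
  rewrite !mxE /= mulr1n.
  have [a0|a0] := eqVneq a 0.
    by rewrite a0 invr0; lra.
  congr (0 <= _).
  set r := (X in _ + X = X - _).
  by field.
have [L EL] := IHn _ psdS.
exists (block_mx (Num.sqrt a)%:M 0 ((Num.sqrt a)^-1 *: b) L).
rewrite tr_block_mx mulmx_block !trmx0 !mulmx0 !mul0mx !addr0.
rewrite tr_scalar_mx -scalar_mxM -expr2 sqr_sqrtr // linearZ /=.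
rewrite -!scalemxAl -!scalemxAr mul_scalar_mx mul_mx_scalar !scalerA.
rewrite -EL -invfM -expr2 sqr_sqrtr // addrC subrK.
have [a0|a0] := eqVneq a 0.
  by rewrite b0 // !trmx0 !scaler0.
have sa : Num.sqrt a != 0 by rewrite sqrtr_eq0 -ltNge lt_neqAle eq_sym a0.
by rewrite mulVf // !scale1r.
Qed.

(** With [P = L *m L^T], cyclicity turns the trace into that of the congruence [L^T *m M *m L]. *)
Lemma tr_mul_ge0 (R : realType) (n : nat) (M P : 'M[R]_n) :
  nonneg_form M -> psd P -> 0 <= \tr (M *m P).
Proof.
move=> hM /psd_cholesky[L ->].
rewrite mulmxA mxtrace_mulC mulmxA.
exact/nonneg_form_tr/nonneg_form_congr.
Qed.

Lemma gram_eq0 (R : realType) (n k : nat) (V : 'M[R]_(n, k)) :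
  \tr (V^T *m V) = 0 -> V = 0.
Proof.
move=> h; apply/matrixP => i j; rewrite mxE.
have H (l : 'I_k) : 0 <= (V^T *m V) l l.
  by rewrite mxE; apply: sumr_ge0 => q _; rewrite mxE -expr2 sqr_ge0.
have hj : (V^T *m V) j j = 0 := psumr_eq0P (fun l _ => H l) h isT.
rewrite mxE in hj.
have G (l : 'I_n) : 0 <= V^T j l * V l j by rewrite mxE -expr2 sqr_ge0.
have : V^T j i * V i j = 0 := psumr_eq0P (fun l _ => G l) hj isT.
by rewrite mxE => /eqP; rewrite mulf_eq0 orbb => /eqP.
Qed.

(** Compressing the Gramian equation by [W] kills both [A] terms, since [P *m W] and [W^T *m P]
    vanish. The traces left, of the [N] term and of the Gram matrix of [B^T *m W], are nonnegative
    with sum zero. *)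
Lemma gramian_ker (R : realType) (n m k : nat) (A N : 'M[R]_n)
    (B : 'M[R]_(n, m)) (P : 'M[R]_n) (W : 'M[R]_(n, k)) :
  controllability_gramian A N B P -> P *m W = 0 -> B^T *m W = 0.
Proof.
case; rewrite /loewner_le subr0 => -[symP posP] eqP0 PW0.
have WP0 : W^T *m P = 0 by rewrite -[P]symP -trmx_mul PW0 trmx0.
have := congr1 (fun M => \tr (W^T *m M *m W)) eqP0.
rewrite !mulmxDr !mulmxDl mulmxN mulNmx !mxtraceD raddfN /=.
have -> : W^T *m (A *m P) *m W = 0 by rewrite -!mulmxA PW0 !mulmx0.
have -> : W^T *m (P *m A^T) *m W = 0 by rewrite mulmxA WP0 !mul0mx.
have : 0 <= \tr (W^T *m (N *m P *m N^T) *m W).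
  apply/nonneg_form_tr/nonneg_form_congr.
  by rewrite -{1}[N]trmxK; exact: nonneg_form_congr.
have EB : W^T *m (B *m B^T) *m W = (B^T *m W)^T *m (B^T *m W).
  by rewrite trmx_mul trmxK !mulmxA.
rewrite {}EB mxtrace0 !add0r => h0 h1.
apply: gram_eq0; apply/eqP; rewrite eq_le.
rewrite (nonneg_form_tr (nonneg_form_gram _)) andbT; lra.
Qed.

Lemma ler_entry_enorm (R : realType) (n : nat) (v : 'cV[R]_n) (i : 'I_n) :
  `|v i 0| <= enorm v.
Proof.
rewrite -sqrtr_sqr ler_sqrt; last by apply: sumr_ge0 => j _; exact: sqr_ge0.
by rewrite (bigD1 i) //= lerDl; apply: sumr_ge0 => j _; exact: sqr_ge0.
Qed.

(** Entries of a vector in the unit ball are at most 1 in absolute value, so absolute row sums bound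
    the entries of [M *m v]. This makes the [sup] a genuine supremum. *)
Lemma spectral_norm_has_ubound (R : realType) (m n : nat) (M : 'M[R]_(m, n)) :
  has_ubound [set enorm (M *m v) | v in [set v : 'cV[R]_n | enorm v <= 1]]%classic.
Proof.
exists (Num.sqrt (\sum_(i < m) (\sum_(j < n) `|M i j|) ^+ 2)) => _ [v /= v1 <-].
apply: ler_wsqrtr; apply: ler_sum => i _.
rewrite -real_normK ?num_real // lerXn2r ?nnegrE ?sumr_ge0 //.
rewrite mxE; apply: le_trans (ler_norm_sum _ _ _) _.
apply: ler_sum => j _; rewrite normrM ler_piMr //.
exact: le_trans (ler_entry_enorm _ _) v1.
Qed.

Lemma enorm_mul_le_spectral_norm (R : realType) (m n : nat)
    (M : 'M[R]_(m, n)) (v : 'cV[R]_n) :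
  enorm v <= 1 -> enorm (M *m v) <= spectral_norm M.
Proof.
move=> v1; apply: sup_upper_bound; last by exists v.
by split; [exists (enorm (M *m v)), v | exact: spectral_norm_has_ubound].
Qed.

Lemma spectral_norm_ge0 (R : realType) (m n : nat) (M : 'M[R]_(m, n)) :
  0 <= spectral_norm M.
Proof.
apply: le_trans (sqrtr_ge0 _) (@enorm_mul_le_spectral_norm _ _ _ M 0 _).
by rewrite /enorm big1 ?sqrtr0 // => i _; rewrite mxE expr0n.
Qed.

(** The entry is a coordinate of the image of a unit basis vector. *)
Lemma diag_le_spectral_norm (R : realType) (n : nat) (M : 'M[R]_n) (i : 'I_n) :
  `|M i i| <= spectral_norm M.
Proof.
have -> : M i i = (M *m delta_mx i (0 : 'I_1)) i 0 by rewrite -colE mxE.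
apply: le_trans (ler_entry_enorm _ _) (enorm_mul_le_spectral_norm _ _).
rewrite /enorm (bigD1 i) //= big1 => [|j ji].
  by rewrite mxE !eqxx expr1n addr0 sqrtr1.
by rewrite mxE (negbTE ji) expr0n.
Qed.

Lemma tr_le_spectral_norm (R : realType) (n : nat) (M : 'M[R]_n) :
  \tr M <= n%:R * spectral_norm M.
Proof.
rewrite mulr_natl -[X in _ *+ X]card_ord -sumr_const; apply: ler_sum => i _.
exact: le_trans (ler_norm _) (diag_le_spectral_norm M i).
Qed.

Theorem lemma2p5 (R : realType) (n m p : nat)
    (A N : 'M[R]_n) (B : 'M[R]_(n, m)) (C : 'M[R]_(p, n)) (D : 'M[R]_(p, m))
    (gamma : R) (P Pd X : 'M[R]_n)
    (hstable : mean_square_stable A N)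
    (hgamma : spectral_norm D < gamma)
    (hP : controllability_gramian A N B P)
    (hPd : moore_penrose P Pd)
    (hX : loewner_le X 0)
    (hLMI : loewner_le 0
       (block_mx (A^T *m X + X *m A + N^T *m X *m N - C^T *m C)
                 (X *m B - C^T *m D)
                 (B^T *m X - D^T *m C)
                 ((gamma ^+ 2)%:M - D^T *m D))) :
  0 <= \tr (- (B^T *m X *m B))
    <= m%:R ^+ 2 * gamma ^+ 2 * spectral_norm (B^T *m Pd *m B).
Proof.
apply/andP; split.
  have [_ posX] := hX; rewrite sub0r in posX.
  rewrite -mulNmx -mulmxN.
  exact/nonneg_form_tr/nonneg_form_congr.
set K := B^T *m Pd.
have KP : K *m P = B^T.
  have [PPdP _ _ _] := hPd.
  (* The first Penrose equation puts the columns of [1 - Pd *m P] in the kernel of [P], hence in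
     that of [B^T]. *)
  have /(gramian_ker hP) : P *m (1%:M - Pd *m P) = 0.
    by rewrite mulmxBr mulmx1 mulmxA PPdP subrr.
  by rewrite mulmxBr mulmx1 mulmxA => /eqP; rewrite subr_eq0 => /eqP.
clearbody K.
have [psdP eqP0] := hP; rewrite /loewner_le subr0 in psdP.
have [symP _] := psdP.
have PK : P *m K^T = B by rewrite -[P]symP -trmx_mul KP trmxK.
have [_ posL] := hLMI; rewrite subr0 in posL.
have := tr_mul_ge0 (nonneg_form_congr (col_mx 1%:M K) posL) psdP.
(* On the graph of [K], the terms in [C] and [D] of the matrix inequality combine to minus this Gram
   matrix. *)
have := tr_mul_ge0 (nonneg_form_gram (C + D *m K)) psdP.
rewrite tr_col_mx trmx1 mul_row_block mul_row_col !mul1mx mulmx1.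
have := congr1 (fun M => \tr (X *m M)) eqP0.
(* Cyclicity, transposition and [K *m P = B^T] reduce the traces to a few common atoms, in which the
   final inequality is linear. *)
have XBKP : \tr (X *m B *m K *m P) = \tr (B^T *m X *m B).
  by rewrite -mulmxA KP mxtrace_mulC mulmxA.
have KBXP : \tr (K^T *m B^T *m X *m P) = \tr (B^T *m X *m B).
  by rewrite mxtrace_mulC !mulmxA PK -mulmxA mxtrace_mulC.
have KKP : \tr (K^T *m K *m P) = \tr (K *m B).
  by rewrite -mulmxA KP -trmx_mul mxtrace_tr mxtrace_mulC.
have XAP : \tr (X *m P *m A^T) = \tr (A^T *m X *m P).
  by rewrite -[in RHS]mulmxA [RHS]mxtrace_mulC.
have XNP : \tr (X *m N *m P *m N^T) = \tr (N^T *m X *m N *m P).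
  by rewrite mxtrace_mulC !mulmxA.
have XBB : \tr (X *m B *m B^T) = \tr (B^T *m X *m B).
  by rewrite mxtrace_mulC mulmxA.
have -> : (C + D *m K)^T = C^T + K^T *m D^T by rewrite linearD /= trmx_mul.
rewrite mulmxN raddfN /=.
rewrite !(mulmxDr, mulmxDl, mulmxBr, mulmxBl, mulNmx, mulmxN, mulmxA).
rewrite mul_mx_scalar -!scalemxAl !(mxtraceD, raddfN, mxtraceZ) /=.
rewrite XBKP KBXP KKP XAP XNP XBB.
(* The trace estimate gives the factor [m], and [m <= m ^ 2] for every natural number, zero
   included. *)
have m_le : m%:R * spectral_norm (K *m B) <= m%:R ^+ 2 * spectral_norm (K *m B).
  rewrite ler_wpM2r ?spectral_norm_ge0 // -natrX ler_nat.
  by case: (m) => // k; rewrite leq_pmulr.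
have := ler_wpM2l (sqr_ge0 gamma) (le_trans (tr_le_spectral_norm _) m_le).
(* With [t = \tr (B^T *m X *m B)], the cross terms give [2 * t] and the Gramian equation gives
   [- t], so [- t <= gamma ^+ 2 * \tr (K *m B)]. *)
lra.
Qed.
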